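(* Let $n\ge 2$ be any integer (prime or composite), $d\ge 1$, $\alpha>1$, and let $\{\gamma_{u}\}_{u\subset\mathbb N}$ be positive weights with $\gamma_\emptyset=1$. Let $\mathbf z=(z_1,\ldots,z_d)\in\mathbb U_n^d$ be a generating vector produced by the component-by-component (CBC) algorithm described in the context. Then for every $\lambda\in(\frac1\alpha,1]$, $$S_{n,d,\alpha,\boldsymbol\gamma}(\mathbf z)\le\Bigg[\frac{\kappa}{\varphi(n)}\bigg(\sum_{\emptyset\ne u\subseteq\{1:d\}}|u|\,\gamma_u^{\lambda}[2\zeta(\alpha\lambda)]^{|u|}\bigg)\bigg(\sum_{u\subseteq\{1:d\}}\gamma_u^{\lambda}[2\zeta(\alpha\lambda)]^{|u|}\bigg)\Bigg]^{1/\lambda},$$ where $\kappa:=2^{2\alpha\lambda+1}+1$.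
   Context: Notation: $\{1:d\}=\{1,\ldots,d\}$, $\{s+1:d\}=\{s+1,\ldots,d\}$ (empty if $s=d$); $\zeta(x)=\sum_{h\ge1}h^{-x}$ is the Riemann zeta function. Weights $\boldsymbol\gamma=\{\gamma_u\}$ are positive reals indexed by finite subsets $u\subset\mathbb N$, with $\gamma_\emptyset=1$. For $\mathbf h\in\mathbb Z^d$, $\mathrm{supp}(\mathbf h)=\{j:h_j\neq0\}$ and $r_{d,\alpha,\boldsymbol\gamma}(\mathbf h)=\gamma_{\mathrm{supp}(\mathbf h)}^{-1}\prod_{j\in\mathrm{supp}(\mathbf h)}|h_j|^\alpha$ (so it equals $1$ at $\mathbf h=\mathbf 0$); also $r'(\mathbf h)=\prod_{j\in\mathrm{supp}(\mathbf h)}|h_j|^\alpha$. Let $\mathbb U_n=\{z\in\mathbb Z:1\le z\le n-1,\ \gcd(z,n)=1\}$ and $\varphi(n)=|\mathbb U_n|$ (Euler's totient). ''$a\equiv_n b$'' means congruence mod $n$. Define $$S_{n,d,\alpha,\boldsymbol\gamma}(\mathbf z)=\sum_{\mathbf h\in\mathbb Z^d}\frac{1}{r_{d,\alpha,\boldsymbol\gamma}(\mathbf h)}\sum_{\substack{\boldsymbol\ell\in\mathbb Z^d\setminus\{\mathbf 0\}\\ \boldsymbol\ell\cdot\mathbf z\equiv_n0}}\frac{1}{r_{d,\alpha,\boldsymbol\gamma}(\mathbf h+\boldsymbol\ell)}.$$ For $s\ge1$, integers $z_1,\ldots,z_s$ and a family of numbers $\{\beta_u\}_{u\subseteq\{1:s\}}$,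 define $$\theta_{n,s,\alpha}(z_1,\ldots,z_s;\{\beta_u\})=\sum_{\mathbf h\in\mathbb Z^s}\sum_{\substack{\boldsymbol\ell\in\mathbb Z^s,\ \ell_s\ne0\\ \boldsymbol\ell\cdot(z_1,\ldots,z_s)\equiv_n0}}\frac{\beta_{\mathrm{supp}(\mathbf h)}}{r'(\mathbf h)}\frac{\beta_{\mathrm{supp}(\mathbf h+\boldsymbol\ell)}}{r'(\mathbf h+\boldsymbol\ell)},$$ and for $1\le s\le d$, $$T_{n,d,s,\alpha,\boldsymbol\gamma}(z_1,\ldots,z_s)=\sum_{w\subseteq\{s+1:d\}}[2\zeta(2\alpha)]^{|w|}\,\theta_{n,s,\alpha}\big(z_1,\ldots,z_s;\{\gamma_{u\cup w}\}_{u\subseteq\{1:s\}}\big).$$ CBC algorithm (for given $n,d,\alpha,\boldsymbol\gamma$): for $s=1,\ldots,d$ in turn, with $z_1,\ldots,z_{s-1}$ already fixed, choose $z_s\in\mathbb U_n$ minimizing $T_{n,d,s,\alpha,\boldsymbol\gamma}(z_1,\ldots,z_{s-1},z_s)$. *)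

(* Defs.v *)
From HB Require Import structures.
From mathcomp Require Import all_boot all_order all_algebra.
From mathcomp Require Import all_classical all_reals all_analysis.
Set Implicit Arguments. Unset Strict Implicit. Unset Printing Implicit Defensive.
Import Order.TTheory GRing.Theory Num.Theory.
Local Open Scope classical_set_scope.
Local Open Scope ring_scope.

Section Defs.
Variable R : realType.

Definition zeta (x : R) : R :=
  limn (fun N : nat => \sum_(1 <= h < N) ((h%:R : R) `^ (- x))).

Definition Un (n : nat) : pred nat := [pred z | (0 < z < n)%N && coprime z n].

(* integer vectors in Z^s, indices 0..s-1 standing for 1..s *)
Definition supp s (h : {ffun 'I_s -> int}) : {set 'I_s} := [set j | h j != 0].

Definition rprime s (alpha : R) (h : {ffun 'I_s -> int}) : R :=
  \prod_(j in supp h) ((`|h j|%:~R : R) `^ alpha).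

Definition vadd s (h l : {ffun 'I_s -> int}) : {ffun 'I_s -> int} :=
  [ffun j => h j + l j].

Definition dotz s (l : {ffun 'I_s -> int}) (z : 'I_s -> nat) : int :=
  \sum_(j < s) l j * (z j)%:Z.

Definition inv_r d (alpha : R) (gamma : {set 'I_d} -> R) (h : {ffun 'I_d -> int}) : R :=
  gamma (supp h) / rprime alpha h.

Definition Ssum (n d : nat) (alpha : R) (gamma : {set 'I_d} -> R)
  (z : 'I_d -> nat) : \bar R :=
  \esum_(h in [set: {ffun 'I_d -> int}])
    \esum_(l in [set l : {ffun 'I_d -> int} | l != 0 /\ (n%:Z %| dotz l z)%Z])
      (inv_r alpha gamma h * inv_r alpha gamma (vadd h l))%:E.

(* theta_{n,s,alpha}(z_1..z_s; beta); the condition l_s <> 0 concerns the last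
   coordinate, of index s-1 in 'I_s. *)
Definition theta (n s : nat) (alpha : R) (beta : {set 'I_s} -> R)
  (z : 'I_s -> nat) : \bar R :=
  \esum_(h in [set: {ffun 'I_s -> int}])
    \esum_(l in [set l : {ffun 'I_s -> int} |
                 [exists j : 'I_s, (val j == s.-1) && (l j != 0)] /\ (n%:Z %| dotz l z)%Z])
      (beta (supp h) / rprime alpha h * (beta (supp (vadd h l)) / rprime alpha (vadd h l)))%:E.

(* T_{n,d,s,alpha,gamma}(z_1..z_s) with s = k+1 for k : 'I_d; w ranges over the
   subsets of {s+1:d}, i.e. 0-based indices j > k. *)
Definition Tcrit (n d : nat) (alpha : R) (gamma : {set 'I_d} -> R) (k : 'I_d)
  (zs : 'I_k.+1 -> nat) : \bar R :=
  (\sum_(w : {set 'I_d} | [forall j in w, (k < j)%N])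
     ((2 * zeta (2 * alpha)) ^+ #|w|)%:E *
     theta n alpha (fun u : {set 'I_k.+1} => gamma ((widen_ord (ltn_ord k)) @: u :|: w)) zs)%E.

Definition zprefix d (z : 'I_d -> nat) (k : 'I_d) (c : nat) : 'I_k.+1 -> nat :=
  fun j => if (val j < k)%N then z (widen_ord (ltn_ord k) j) else c.

End Defs.
Arguments zprefix {d} z k c _.
Arguments Tcrit {R} n {d} alpha gamma k zs.
Section CBC.
Variable R : realType.
Definition is_CBC (n d : nat) (alpha : R) (gamma : {set 'I_d} -> R) (z : 'I_d -> nat) : Prop :=
  forall k : 'I_d, z k \in Un n /\
    forall c, c \in Un n ->
      (Tcrit n alpha gamma k (zprefix z k (z k)) <= Tcrit n alpha gamma k (zprefix z k c))%E.

End CBC.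

(* Main.v *)
Require Import Defs.
From HB Require Import structures.
From mathcomp Require Import all_boot all_order all_algebra.
From mathcomp Require Import all_classical all_reals all_analysis.
From mathcomp Require Import ring lra zify.
Import Order.TTheory GRing.Theory Num.Theory.
Local Open Scope classical_set_scope.
Local Open Scope ring_scope.

(** Splitting the nonzero [l] in [S] by its last nonzero coordinate [k], and
summing out the coordinates of [h] beyond [k], gives [S = sum_k T_k], where
[T_k] is the quantity minimised by the algorithm at step [k]. The minimum is at
most the average over the units of [Z/n], and since [x `^ lambda] is subadditive,
[T_k `^ lambda] is bounded by the average of the same double sum with
[a = alpha * lambda] and [gamma `^ lambda] in place of [alpha] and [gamma].

The average is controlled by two one-dimensional estimates. For fixed [e],
[sum_y #{c unit : n | y c + e} |y|^-a <= 2 zeta(a)]: a unit solution forces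
[gcd(y, n) = gcd(e, n) =: g], and then there are at most [g] solutions, while
[sum_(g | y) g |y|^-a <= sum_y |y|^-a]. For [y <> 0],
[sum_x |x|^-a |x + y|^-a <= 2^(a+1) (2 zeta(a)) |y|^-a], since one of [|x|],
[|x + y|] is at least [|y| / 2]. These give the constant [2^(a+1)], which is
smaller than [kappa]. *)

(** * Extended sums and subadditivity of powers *)

Section ExtendedSums.
Context {R : realType}.

Lemma esum_exchange {T1 T2 : choiceType} (I : set T1) (J : set T2)
    (a : T1 -> T2 -> \bar R) :
  (forall i j, I i -> J j -> (0 <= a i j)%E) ->
  \esum_(i in I) \esum_(j in J) a i j = \esum_(j in J) \esum_(i in I) a i j.
Proof.
move=> a0; rewrite (@esum_esum _ _ _ I (fun=> J))//.
rewrite (@esum_esum _ _ _ J (fun=> I)); last by move=> i j Ji Ij; exact: a0.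
rewrite (@reindex_esum _ _ _ (J `*`` (fun=> I)) _ (fun x => (x.2, x.1)))//.
split => [[i j] [/= ? ?]|[i j] [i' j'] _ _ /= [-> ->]|[i j] [/= ? ?]] //.
by exists (j, i).
Qed.

Lemma esumZl {T : choiceType} (I : set T) (k : R) (a : T -> \bar R) :
  0 <= k -> (forall i, I i -> (0 <= a i)%E) ->
  (\esum_(i in I) (k%:E * a i) = k%:E * \esum_(i in I) a i)%E.
Proof.
move=> k0 a0; rewrite /esum -ereal_supZl//; last first.
  (* The set of finite subsums is nonempty, since it contains the empty sum. *)
  apply/set0P; exists 0%E; exists set0; first exact: fsets_set0.
  by rewrite fsbig_set0.
rewrite image_comp; congr ereal_sup; apply: eq_imagel => X [finX XI] /=.
rewrite !fsbig_finite//= big_seq [in RHS]big_seq ge0_sume_distrr// => i.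
by rewrite in_fset_set// inE => /XI/a0.
Qed.

Lemma esum_subset {T : choiceType} {I J : set T} (a : T -> \bar R) :
  I `<=` J -> (\esum_(i in I) a i <= \esum_(i in J) a i)%E.
Proof.
move=> IJ; apply: ge_ereal_sup => _ [X [finX XI] <-].
by apply: ereal_sup_ubound; exists X => //; split => //; exact: subset_trans IJ.
Qed.

Lemma esum_inj_le {T1 T2 : choiceType} {I : set T1} {J : set T2} (e : T1 -> T2)
    (a : T2 -> \bar R) :
  set_inj I e -> (forall i, I i -> J (e i)) ->
  (\esum_(i in I) a (e i) <= \esum_(j in J) a j)%E.
Proof.
move=> ei eI; rewrite -(esum_image I e)//; apply: esum_subset => //.
by move=> _ [i Ii <-]; exact: eI.
Qed.

(** A ratio [t = u / (x + y)] in [[0, 1]] satisfies [t <= t ^ p] because [p <= 1]. Scale by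
    [(x + y) ^ p] and add the cases [u = x] and [u = y], whose ratios sum to 1. *)
Lemma powRD_le (x y p : R) : 0 <= x -> 0 <= y -> 0 < p -> p <= 1 ->
  (x + y) `^ p <= x `^ p + y `^ p.
Proof.
move=> x0 y0 p0 p1; have [xy0|xyn0] := eqVneq (x + y) 0.
  by rewrite xy0 powR0 ?gt_eqF// addr_ge0 ?powR_ge0.
have xyp : 0 < x + y by rewrite lt_neqAle eq_sym xyn0 addr_ge0.
have key u : 0 <= u -> u <= x + y -> (x + y) `^ p * (u / (x + y)) <= u `^ p.
  move=> u0 ule; have [->|un0] := eqVneq u 0.
    by rewrite mul0r mulr0 powR_ge0.
  have up : 0 < u by rewrite lt_neqAle eq_sym un0.
  have -> : u `^ p = (x + y) `^ p * (u / (x + y)) `^ p.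
    by rewrite -powRM ?divr_ge0 ?ltW// mulrC divfK.
  rewrite ler_wpM2l ?powR_ge0// ger1_powR// divr_gt0//=.
  by rewrite ler_pdivrMr// mul1r.
apply: le_trans (lerD (key x _ _) (key y _ _)) => //; last 2 first.
- by rewrite lerDl.
- by rewrite lerDr.
by rewrite -mulrDr -mulrDl divff// mulr1.
Qed.

Lemma poweRD_le (x y : \bar R) (p : R) : (0 <= x)%E -> (0 <= y)%E ->
  0 < p -> p <= 1 -> ((x + y) `^ p <= x `^ p + y `^ p)%E.
Proof.
move=> x0 y0 p0 p1; have pn0 : p != 0 by rewrite gt_eqF.
have ny z : (z `^ p)%E != -oo%E :> \bar R.
  by rewrite -ltNye (lt_le_trans _ (poweR_ge0 _ _))// ltNyr.
case: x x0 => [x| |]// x0; last by rewrite (poweRyr pn0) [leRHS]addye ?leey.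
case: y y0 => [y| |]// y0; last by rewrite (poweRyr pn0) [leRHS]addey ?leey.
by rewrite -EFinD !poweR_EFin -EFinD lee_fin powRD_le.
Qed.

Lemma sum_poweR_le {T : Type} (s : seq T) (P : pred T) (f : T -> \bar R) (p : R) :
  (forall i, P i -> (0 <= f i)%E) -> 0 < p -> p <= 1 ->
  ((\sum_(i <- s | P i) f i) `^ p <= \sum_(i <- s | P i) f i `^ p)%E.
Proof.
move=> f0 p0 p1; elim: s => [|i s IH]; first by rewrite !big_nil poweR0r ?gt_eqF.
rewrite !big_cons; case: ifP => // Pi.
apply: le_trans (poweRD_le _ _ _ _ _ p0 p1) _; [exact: f0|exact: sume_ge0|].
exact: leeD2l.
Qed.

Lemma le_poweR_inv (x y : \bar R) (p : R) : 0 < p -> (0 <= x)%E ->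
  (x `^ p <= y)%E -> (x <= y `^ p^-1)%E.
Proof.
move=> p0 x0 xy; rewrite -[leLHS]poweRe1// -(mulfV (lt0r_neq0 p0)) poweRrM.
have y0 := le_trans (poweR_ge0 _ _) xy.
apply: gt0_ler_poweR => //; first by rewrite invr_ge0 ltW.
- by rewrite in_itv/= poweR_ge0 leey.
- by rewrite in_itv/= y0 leey.
Qed.

Lemma esum_poweR_le {T : choiceType} (I : set T) (f : T -> \bar R) (p : R) :
  (forall i, I i -> (0 <= f i)%E) -> 0 < p -> p <= 1 ->
  ((\esum_(i in I) f i) `^ p <= \esum_(i in I) f i `^ p)%E.
Proof.
move=> f0 p0 p1; have s0 : (0 <= \esum_(i in I) f i)%E by exact: esum_ge0.
(* The extended sum is a supremum, so it is isolated on the left: the inverse power moves to the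
   right, and each finite subsum can be bounded separately. *)
suff : (\esum_(i in I) f i <= (\esum_(i in I) f i `^ p) `^ p^-1)%E.
  move=> le1; apply: le_trans (gt0_ler_poweR (ltW p0) _ _ le1) _.
  - by rewrite in_itv/= s0 leey.
  - by rewrite in_itv/= poweR_ge0 leey.
  rewrite -poweRrM mulVf ?gt_eqF// poweRe1//.
  by apply: esum_ge0 => i _; exact: poweR_ge0.
apply: ge_ereal_sup => _ [X [finX XI] <-].
apply: le_poweR_inv => //.
  rewrite fsbig_finite//= big_seq sume_ge0// => i.
  by rewrite in_fset_set// inE => /XI/f0.
rewrite fsbig_finite//= big_seq.
apply: le_trans (sum_poweR_le _ _ _ _ _ p0 p1) _.
  by move=> i; rewrite in_fset_set// inE => /XI/f0.
by rewrite -big_seq -fsbig_finite//; apply: ereal_sup_ubound; exists X.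
Qed.

End ExtendedSums.

(** * Negative powers of absolute values on the integers and their sums *)

Section Rho.
Context {R : realType}.
Implicit Types (a b : R) (x y : int).

(* [powR] gives [0 `^ (- b) = 0] for [b != 0], so [rho b 0 = 0]. *)
Definition rho b x : R := (`|x|%:~R : R) `^ (- b).

Lemma rho_ge0 b x : 0 <= rho b x. Proof. exact: powR_ge0. Qed.

Lemma rho0 b : b != 0 -> rho b 0 = 0.
Proof. by move=> b0; rewrite /rho normr0 powR0 ?oppr_eq0. Qed.

Lemma rhoN b x : rho b (- x) = rho b x.
Proof. by rewrite /rho normrN. Qed.

Lemma rhoM b x y : rho b (x * y) = rho b x * rho b y.
Proof. by rewrite /rho normrM rmorphM powRM// ler0z. Qed.

(** Cauchy condensation: [S (2M) <= 1 + r * S M] for [M >= 1], and [S M <= S (2M)] closes this into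
    a bound on [S (2M)] because [r < 1]. *)
Lemma rho_sum_le a N : 1 < a ->
  \sum_(0 <= h < N) rho a h%:Z <= (1 - 2 `^ (1 - a))^-1.
Proof.
move=> a1; have a0 : a != 0 by rewrite gt_eqF// (lt_trans ltr01).
set r := 2 `^ (1 - a); set S := fun N => \sum_(0 <= h < N) rho a h%:Z.
have r1 : 0 < 1 - r.
  rewrite subr_gt0 -(powRr0 2) /r /powR pnatr_eq0/= ltr_expR mul0r.
  by rewrite nmulr_rlt0 ?subr_lt0// ln_gt0 ?ltr1n.
have r2 : r = 2 * rho a 2.
  by rewrite /r powRD ?pnatr_eq0 ?implybT// powRr1 /rho.
have rdec m n : (0 < m <= n)%N -> rho a n%:Z <= rho a m%:Z.
  move=> /andP[m0 mn]; rewrite /rho !powRN lef_pV2 ?posrE; last 2 first.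
  - by rewrite powR_gt0// ltr0z; lia.
  - by rewrite powR_gt0// ltr0z; lia.
  by apply: ge0_ler_powR; rewrite ?nnegrE ?ler0z ?ler_int//; lra.
(* Indices 0 and 1 contribute 1 in total; each later pair [2m], [2m + 1] adds at most
   [2 * rho a (2m) = r * rho a m]. *)
have rec M : S M.+1.*2 <= 1 + r * S M.+1.
  elim: M => [|M IH].
    rewrite /S !big_nat_recr //= !big_geq//= !add0r rho0// mulr0 addr0 add0r.
    by rewrite /rho normr1 powR1.
  rewrite doubleS /S [in leRHS]big_nat_recr//= [in leLHS]big_nat_recr//=.
  rewrite [in leLHS]big_nat_recr//= -/(S _) -/(S _) mulrDr addrA -addrA lerD//.
  have -> : M.+1.*2%:Z = 2 * M.+1%:Z by rewrite -muln2 PoszM mulrC.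
  have : rho a M.+1.*2.+1%:Z <= rho a (M.+1.*2)%:Z by apply: rdec; lia.
  have -> : M.+1.*2%:Z = 2 * M.+1%:Z by rewrite -muln2 PoszM mulrC.
  rewrite rhoM r2; lra.
have mono m n : (m <= n)%N -> S m <= S n.
  by move=> mn; rewrite /S [leRHS](big_cat_nat (n := m))//= lerDl sumr_ge0// => i _; exact: rho_ge0.
apply: (@le_trans _ _ (S N.+1.*2)); first by apply: mono; lia.
have := rec N; have : S N.+1 <= S N.+1.*2 by apply: mono; lia.
move=> h1 h2; rewrite -[leRHS]mul1r ler_pdivlMr//.
have : r * S N.+1 <= r * S N.+1.*2 by rewrite ler_wpM2l// powR_ge0.
lra.
Qed.

(** [zeta] is a bare [limn], so it is the value of the series only once convergence is known; the
    partial sums are monotone and bounded by [rho_sum_le]. Starting at 0 instead of 1 is harmless as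
    [rho a 0 = 0]. *)
Lemma esum_rho_nat a : 1 < a ->
  \esum_(h in [set: nat]) (rho a h%:Z)%:E = (zeta a)%:E.
Proof.
move=> a1; rewrite -nneseries_esumT; last by move=> h; rewrite lee_fin rho_ge0.
rewrite /zeta; have -> : (fun N => \sum_(1 <= h < N) (h%:R : R) `^ (- a)) =
    (fun N => \sum_(0 <= h < N) rho a h%:Z).
  apply/funext => -[|N]; first by rewrite !big_geq.
  rewrite [RHS]big_nat_recl// rho0 ?gt_eqF ?(lt_trans ltr01)// add0r big_add1 /=.
  by apply: eq_bigr => i _; rewrite /rho.
rewrite -EFin_lim; first by congr (limn _); apply/funext => N; rewrite /= sumEFin.
apply: nondecreasing_is_cvgn.
  by apply: nondecreasing_series => n _ _; exact: rho_ge0.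
by exists (1 - 2 `^ (1 - a))^-1 => _ [N _ <-]; exact: rho_sum_le.
Qed.

(** The nonnegative and the nonpositive integers each give [zeta a]; they overlap only at 0, where
    [rho a] vanishes. *)
Lemma esum_rho a : 1 < a -> \esum_(x in [set: int]) (rho a x)%:E = (2 * zeta a)%:E.
Proof.
move=> a1; have a0 : a != 0 by rewrite gt_eqF// (lt_trans ltr01).
have split x : ((rho a x)%:E = (if x \in range Posz then (rho a x)%:E else 0) +
    (if x \in range (fun h => (- Posz h)%R) then (rho a x)%:E else 0))%E.
  case: x => [[|m]|m].
  - by rewrite rho0// !if_same adde0.
  - rewrite mem_set; last by exists m.+1.
    rewrite memNset ?adde0// => -[[|k]//].
  - rewrite memNset ?add0e; last by case.
    by rewrite mem_set//; exists m.+1.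
rewrite (eq_esum (fun x _ => split x)) esumD; last 2 first.
- by move=> x _; case: ifP => // _; rewrite lee_fin rho_ge0.
- by move=> x _; case: ifP => // _; rewrite lee_fin rho_ge0.
rewrite -!esum_mkcond !esum_image; last 2 first.
- by move=> i j _ _ /eqP; rewrite eqr_opp => /eqP[].
- by move=> i j _ _ [].
under [X in (_ + X)%E]eq_esum do rewrite rhoN.
by rewrite esum_rho_nat// -EFinD mulr2n mulrDl mul1r.
Qed.

Lemma zeta_ge0 a : 1 < a -> 0 <= zeta a.
Proof.
move=> a1; rewrite -lee_fin -esum_rho_nat//.
by apply: esum_ge0 => h _; rewrite lee_fin rho_ge0.
Qed.

Lemma esum_rhoD a y : 1 < a ->
  \esum_(x in [set: int]) (rho a (x + y))%:E = (2 * zeta a)%:E.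
Proof.
move=> a1; rewrite -esum_rho//.
rewrite [RHS](@reindex_esum _ _ _ setT setT (fun x => x + y))//; split => //.
  by move=> i j _ _ /addIr.
by move=> x _; exists (x - y) => //=; rewrite subrK.
Qed.

(* One of [x], [x + y] has absolute value at least [|y| / 2]. *)
Lemma rho_mul_le a x y : 1 < a -> y != 0 ->
  rho a x * rho a (x + y) <= 2 `^ a * rho a y * (rho a x + rho a (x + y)).
Proof.
move=> a1 y0; have a0 : a != 0 by rewrite gt_eqF// (lt_trans ltr01).
have nn (u : int) : 0 <= 2 `^ a * rho a y * rho a u by rewrite !mulr_ge0 ?powR_ge0 ?rho_ge0.
rewrite mulrDr.
have [->|x0] := eqVneq x 0; first by rewrite {1}rho0// mul0r addr_ge0.
have [->|xy0] := eqVneq (x + y) 0; first by rewrite rho0// !mulr0 addr0.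
have half u : u != 0 -> `|y| <= 2 * `|u| -> rho a u <= 2 `^ a * rho a y.
  move=> u0 yu; rewrite /rho !powRN -[2 `^ a]invrK -invfM lef_pV2 ?posrE; last 2 first.
  - by rewrite powR_gt0// ltr0z normr_gt0.
  - by rewrite mulr_gt0 ?invr_gt0 ?powR_gt0// ltr0z normr_gt0.
  rewrite mulrC ler_pdivrMr ?powR_gt0// mulrC -powRM ?ler0n ?ler0z//.
  have a_ge0 : 0 <= a by lra.
  apply: ge0_ler_powR => //; rewrite ?nnegrE ?ler0z ?mulr_ge0 ?ler0z//.
  by rewrite -[2]/(2%:~R) -intrM ler_int.
have [le1|lt1] := lerP `|y| (2 * `|x|).
  apply: le_trans (_ : _ <= 2 `^ a * rho a y * rho a (x + y)) _.
    by rewrite ler_wpM2r ?rho_ge0 ?half.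
  by rewrite lerDr nn.
rewrite mulrC; apply: le_trans (_ : _ <= 2 `^ a * rho a y * rho a x) _.
  by rewrite ler_wpM2r ?rho_ge0 ?half//; lia.
by rewrite lerDl nn.
Qed.

End Rho.

(** * Linear congruences modulo [n] and the one-dimensional estimates *)

Section Congruences.

(** Multiplication by a unit preserves the gcd with [n], and [y c] is congruent to [-e]. *)
Lemma gcdn_solution (n c : nat) (y e : int) : coprime c n ->
  (n%:Z %| y * c%:Z + e)%Z -> gcdn `|y|%N n = gcdn `|e|%N n.
Proof.
move=> cn /dvdzP[q E].
have nc : coprimez n%:Z c%:Z by rewrite coprimezE coprime_sym.
have : gcdz n%:Z (y * c%:Z) = gcdz n%:Z e.
  have -> : y * c%:Z = q * n%:Z + (- e) by lia.
  by rewrite gcdzMDl gcdzN.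
by rewrite (Gauss_gcdzl _ nc) /gcdz => -[]; rewrite gcdnC => ->; rewrite gcdnC.
Qed.

(** With [n = m g], two solutions are congruent modulo [m], so a solution in [[0, n)] is determined
    by its quotient by [m], which is less than [g]. *)
Lemma card_solutions_le (n : nat) (y e : int) : (0 < n)%N ->
  (#|[set c : 'I_n | (n%:Z %| (y * c%:Z + e)%R)%Z]%SET| <= gcdn `|y| n)%N.
Proof.
move=> n0; set g := gcdn `|y| n; set A := [set c : 'I_n | _]%SET.
have g0 : (0 < g)%N by rewrite gcdn_gt0 n0 orbT.
have /dvdnP[m nE] : (g %| n)%N by exact: dvdn_gcdr.
have m0 : (0 < m)%N by move: n0; rewrite nE muln_gt0 => /andP[].
have lt_g (c : 'I_n) : (c %/ m < g)%N by rewrite ltn_divLR// mulnC -nE.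
have inj : {in A &, injective (fun c => Ordinal (lt_g c))}.
  move=> c c'; wlog le_cc' : c c' / (c <= c')%N => [H|].
    case/orP: (leq_total c c') => [/H//|/H H' ? ? E].
    by apply/esym/H'.
  rewrite !inE => Ac Ac' [/eqP E]; apply/val_inj => /=.
  (* Then [n] divides both [y (c' - c)] and [n (c' - c)], hence [g (c' - c)]; cancelling [g] leaves
     [m] dividing [c' - c]. *)
  have : (n %| `|y| * (c' - c))%N.
    have := rpredB Ac' Ac; rewrite dvdzE.
    rewrite (_ : _ + _ - _ = y * (c' - c)%N%:Z); last by rewrite -subzn//; ring.
    by rewrite abszM.
  move=> d1; have d2 : (n %| n * (c' - c))%N by rewrite dvdn_mulr.
  have : (n %| g * (c' - c))%N by rewrite /g muln_gcdl dvdn_gcd d1 d2.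
  rewrite {1}nE mulnC dvdn_pmul2l// -eqn_mod_dvd// => /eqP E'.
  by rewrite (divn_eq c m) (divn_eq c' m) (eqP E) E'.
by rewrite -(card_in_imset inj) -[leqRHS]card_ord max_card.
Qed.

Context {R : realType}.

Definition sol_count (n : nat) (y e : int) : R :=
  \sum_(c < n | val c \in Un n) (n%:Z %| y * (val c)%:Z + e)%Z%:R.

Lemma sol_count_ge0 n y e : 0 <= sol_count n y e.
Proof. by apply: sumr_ge0 => c _; rewrite ler0n. Qed.

(** Without a unit solution the count is 0. With one, [gcdn_solution] turns the bound [gcd(y, n)]
    into [gcd(e, n)], which then divides [y]. *)
Lemma sol_count_le n y e : (0 < n)%N ->
  sol_count n y e <=
  if ((gcdn `|e| n)%:Z %| y)%Z then (gcdn `|e| n)%:R else 0.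
Proof.
move=> n0; rewrite /sol_count.
have [c /andP[cU cd]|none] := pickP (fun c : 'I_n =>
    (val c \in Un n) && (n%:Z %| y * (val c)%:Z + e)%Z); last first.
  rewrite big1; first by case: ifP => // _; rewrite ler0n.
  by move=> c cU; have := none c; rewrite /= cU /= => ->.
have gE := gcdn_solution n c y e (proj2 (andP cU)) cd.
rewrite -gE ifT; last by rewrite dvdzE dvdn_gcdl.
apply: le_trans (_ : (\sum_(c < n) (n%:Z %| y * (val c)%:Z + e)%Z%:R) <= _).
  by rewrite big_mkcond ler_sum// => i _; case: ifP.
rewrite -natr_sum ler_nat; apply: leq_trans (card_solutions_le n y e n0).
by rewrite -sum1dep_card [leqRHS]big_mkcond /=; apply: leq_sum => i _; case: ifP.
Qed.

(* Only [y] with [gcd y n = gcd e n =: g] contribute, each at most [g] times, and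
   [sum_(g | y) g |y|^-a = g^(1-a) sum |m|^-a]. *)
Lemma esum_sol_count_le (a : R) n e : 1 < a -> (0 < n)%N ->
  (\esum_(y in [set: int]) (sol_count n y e * rho a y)%:E <= (2 * zeta a)%:E)%E.
Proof.
move=> a1 n0; set g := gcdn `|e| n.
have g0 : (0 < g)%N by rewrite gcdn_gt0 n0 orbT.
apply: (@le_trans _ _ (\esum_(y in range (fun m => g%:Z * m)) (g%:R * rho a y)%:E)).
  rewrite [leRHS]esum_mkcond; apply: le_esum => y _.
  have := sol_count_le n y e n0; rewrite -/g; case: ifPn => gy le.
    rewrite mem_set; last by case/dvdzP: gy => q ->; exists q; rewrite // mulrC.
    by rewrite lee_fin ler_wpM2r ?rho_ge0.
  apply: le_trans (_ : (0%:E <= _)%E); last first.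
    by case: ifP => // _; rewrite lee_fin mulr_ge0 ?rho_ge0.
  by rewrite lee_fin mulr_le0_ge0 ?rho_ge0.
rewrite esum_image; last first.
  by move=> i j _ _ /mulfI; apply; lia.
rewrite -esum_rho//; apply: le_esum => m _; rewrite lee_fin rhoM mulrA.
rewrite ler_piMl ?rho_ge0// /rho powRN.
rewrite -[leLHS]/((g%:R : R) / (g%:R `^ a)) ler_pdivrMr ?powR_gt0 ?ltr0n// mul1r.
by apply: le1r_powR; rewrite ?ler1n// ltW.
Qed.

(** Sum [rho_mul_le] over [x]: both translates of [rho a] sum to [2 * zeta a], and this doubling
    raises [2 ^ a] to [2 ^ (a + 1)]. *)
Lemma esum_rho_conv (a : R) y : 1 < a -> y != 0 ->
  (\esum_(x in [set: int]) (rho a x * rho a (x + y))%:E <=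
   (2 `^ (a + 1) * (2 * zeta a) * rho a y)%:E)%E.
Proof.
move=> a1 y0.
have k0 : 0 <= 2 `^ a * rho a y by rewrite mulr_ge0 ?powR_ge0 ?rho_ge0.
apply: (@le_trans _ _ (\esum_(x in [set: int])
    ((2 `^ a * rho a y)%:E * ((rho a x)%:E + (rho a (x + y))%:E))%E)).
  by apply: le_esum => x _; rewrite -EFinD -EFinM lee_fin rho_mul_le.
rewrite esumZl//; last by move=> x _; rewrite -EFinD lee_fin addr_ge0 ?rho_ge0.
rewrite esumD; try by move=> x _; rewrite lee_fin rho_ge0.
rewrite esum_rho// esum_rhoD// -EFinD -EFinM lee_fin.
rewrite powRD ?pnatr_eq0 ?implybT// powRr1//.
by rewrite le_eqVlt; apply/orP; left; apply/eqP; ring.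
Qed.

End Congruences.

(** * Sums over integer vectors, one coordinate at a time *)

Lemma esum_delta {R : realType} {T : choiceType} (x0 : T) (r : R) : 0 <= r ->
  \esum_(x in [set: T]) ((x == x0)%:R * r)%:E = r%:E.
Proof.
move=> r0; rewrite -[RHS](@esum_set1 R T x0 (fun=> r%:E)) ?lee_fin//.
rewrite [RHS]esum_mkcond; apply: eq_esum => x _.
have [->|xx0] := eqVneq x x0; first by rewrite mem_set// mul1r.
by rewrite memNset ?mul0r//=; exact/eqP.
Qed.

Section Vectors.
Context {R : realType} {d : nat}.
Local Notation vec := {ffun 'I_d -> int}.
Implicit Types (h l : vec) (s j : 'I_d) (x y : int) (w u : {set 'I_d})
  (a : R) (g : {set 'I_d} -> R).

(** Stands for [Z^w] extended by zeros, so that sums over different sets of coordinates share one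
    vector type. *)
Definition supp_in w : set vec := [set h | supp h \subset w].

Definition upd h s x : vec := [ffun j => if j == s then x else h j].

Lemma supp_inP w h : supp_in w h <-> (forall j, j \notin w -> h j = 0).
Proof.
split=> [/fintype.subsetP sw j|H].
  by apply: contraNeq => hj; apply: sw; rewrite inE.
by apply/fintype.subsetP => j; rewrite inE; apply: contraNT => /H ->.
Qed.

Lemma supp_upd h s x : s \notin supp h ->
  supp (upd h s x) = if x == 0 then supp h else s |: supp h.
Proof.
move=> sh; apply/setP => j; rewrite !inE ffunE.
have [->|js] := eqVneq j s.
  by have [_|_] := eqVneq x 0; rewrite !inE ?eqxx//; move: sh; rewrite inE => /negPf ->.
by case: ifP => _; rewrite !inE// (negPf js).
Qed.

Lemma esum_upd s w (f : vec -> \bar R) : s \notin w -> (forall h, (0 <= f h)%E) ->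
  \esum_(h in supp_in (s |: w)) f h =
  \esum_(h in supp_in w) \esum_(x in [set: int]) f (upd h s x).
Proof.
move=> sw f0; rewrite (@esum_esum _ _ _ (supp_in w) (fun=> setT))//.
rewrite (@reindex_esum _ _ _ (supp_in w `*`` (fun=> setT)) _
  (fun p => upd p.1 s p.2))//; split.
- move=> [h x] [/= /supp_inP H _]; apply/supp_inP => j.
  by rewrite !inE negb_or ffunE => /andP[/negPf -> /H].
- move=> [h x] [h' x']; rewrite !inE => -[/= /supp_inP H _] [/= /supp_inP H' _] E.
  have Ej j : upd h s x j = upd h' s x' j by rewrite E.
  congr (_, _); last by have := Ej s; rewrite !ffunE eqxx.
  apply/ffunP => j; have := Ej j; rewrite !ffunE; case: eqP => // -> _.
  by rewrite H// H'.
- move=> h /supp_inP H; exists (upd h s 0, h s).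
    split=> //=; apply/supp_inP => j jw; rewrite ffunE; case: eqP => // /eqP js.
    by rewrite H// !inE negb_or js.
  by apply/ffunP => j; rewrite !ffunE /=; case: eqP => // ->.
Qed.

Lemma supp0 : supp (0 : vec) = finset.set0.
Proof. by apply/setP => j; rewrite !inE ffunE eqxx. Qed.

Lemma inv_rE a g h : inv_r a g h = g (supp h) * \prod_(j in supp h) rho a (h j).
Proof.
rewrite /inv_r /rprime -prodfV; congr (_ * _); apply: eq_bigr => j _.
by rewrite /rho powRN.
Qed.

Lemma inv_r_ge0 a g h : (forall u, 0 <= g u) -> 0 <= inv_r a g h.
Proof.
by move=> g0; rewrite inv_rE mulr_ge0// prodr_ge0// => j _; exact: rho_ge0.
Qed.

(** This is how the parameters [alpha * lambda] and [gamma ^ lambda] arise after subadditivity has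
    been applied term by term. *)
Lemma inv_r_powR a g h (p : R) : (forall u, 0 <= g u) ->
  inv_r a g h `^ p = inv_r (a * p) (fun u => g u `^ p) h.
Proof.
move=> g0; rewrite !inv_rE powRM ?prodr_ge0//; last by move=> j _; exact: rho_ge0.
congr (_ * _).
(* Nonnegativity is carried through the induction because [powRM] requires it. *)
suff [] : 0 <= \prod_(j in supp h) rho a (h j) /\
  (\prod_(j in supp h) rho a (h j)) `^ p = \prod_(j in supp h) rho (a * p) (h j) by [].
apply: (big_ind2 (fun y z : R => 0 <= y /\ y `^ p = z)).
- by rewrite powR1.
- by move=> y1 z1 y2 z2 [y10 <-] [y20 <-]; rewrite mulr_ge0// powRM.
- by move=> j _; rewrite rho_ge0 /rho -powRrM mulNr.
Qed.

(** Since [rho a 0 = 0], exactly one summand survives: [s] enters the support precisely when [x] is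
    nonzero. The linear form allows summation over [x]. *)
Lemma inv_r_upd a g h s x : a != 0 -> h s = 0 ->
  inv_r a g (upd h s x) =
  (x == 0)%:R * inv_r a g h + rho a x * inv_r a (fun u => g (s |: u)) h.
Proof.
move=> a0 hs; have sh : s \notin supp h by rewrite inE hs eqxx.
rewrite !inv_rE supp_upd//; have [->|x0] := eqVneq x 0.
  rewrite rho0// mul0r addr0 mul1r; congr (_ * _); apply: eq_bigr => j.
  by rewrite ffunE; case: eqP => // ->; rewrite (negPf sh).
rewrite mul0r add0r big_setU1//= ffunE eqxx mulrCA; congr (_ * (_ * _)).
by apply: eq_bigr => j; rewrite ffunE; case: eqP => // ->; rewrite (negPf sh).
Qed.

Lemma sum_subsetU1 s w (F : {set 'I_d} -> R) : s \notin w ->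
  \sum_(u : {set 'I_d} | u \subset s |: w) F u =
  \sum_(u : {set 'I_d} | u \subset w) F u +
  \sum_(u : {set 'I_d} | u \subset w) F (s |: u).
Proof.
move=> sw; rewrite (bigID (fun u : {set 'I_d} => s \in u))/= addrC; congr (_ + _).
  apply: eq_bigl => u; rewrite -[u \subset w]andbT; apply/andP/andP.
    move=> [/fintype.subsetP H su]; split => //; apply/fintype.subsetP => j ju.
    by have := H j ju; rewrite !inE => /orP[/eqP E|//]; rewrite E (negPf su) in ju.
  move=> [uw _]; split; first by rewrite subsetU// uw orbT.
  by apply: contra sw => /(fintype.subsetP uw).
rewrite (reindex_onto (fun u => s |: u) (fun u => u :\ s))/=; last first.
  by move=> u /andP[_ su]; rewrite finset.setD1K.
apply: eq_bigl => u; rewrite finset.setU11 andbT.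
apply/andP/idP => [[uw /eqP E]|uw].
  by rewrite -E finset.subDset.
have su : s \notin u by apply: contra sw => /(fintype.subsetP uw).
by rewrite finset.setUS// finset.setU1K.
Qed.

(** Peeling off a coordinate [s] leaves the sum for [g] plus [2 * zeta a] times the sum for
    [fun u => g (s |: u)]. General weights do not factor, so the induction on [#|w|] ranges over all
    [g]. *)
Lemma esum_inv_r a g w : 1 < a -> (forall u, 0 <= g u) ->
  \esum_(h in supp_in w) (inv_r a g h)%:E =
  (\sum_(u : {set 'I_d} | u \subset w) g u * (2 * zeta a) ^+ #|u|)%:E.
Proof.
move=> a1; have a0 : a != 0 by rewrite gt_eqF// (lt_trans ltr01).
elim: {w}_.+1 {-2}w (ltnSn #|w|) g => // m IH w wm g g0.
have [->|[s sw]] := set_0Vmem w.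
  have -> : supp_in finset.set0 = [set 0].
    apply/seteqP; split => [h /supp_inP H|h ->]; last first.
      by apply/supp_inP => j _; rewrite ffunE.
    by apply/ffunP => j; rewrite ffunE H// inE.
  rewrite esum_set1 ?lee_fin ?inv_r_ge0// (big_pred1 finset.set0); last first.
    by move=> u; rewrite finset.subset0.
  by rewrite inv_rE supp0 big_set0 cards0.
rewrite -(finset.setD1K sw) esum_upd ?finset.setD11//; last first.
  by move=> h; rewrite lee_fin inv_r_ge0.
rewrite sum_subsetU1 ?finset.setD11//.
set w' := w :\ s.
have w'm : (#|w'| < m)%N by move: wm; rewrite (finset.cardsD1 s) sw.
have inner h : supp_in w' h -> \esum_(x in [set: int]) (inv_r a g (upd h s x))%:E =
   ((inv_r a g h)%:E + (2 * zeta a)%:E * (inv_r a (fun u => g (s |: u)) h)%:E)%E.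
  move=> /supp_inP hw; have hs : h s = 0 by apply: hw; rewrite finset.setD11.
  under eq_esum do rewrite inv_r_upd// EFinD [rho _ _ * _]mulrC.
  rewrite esumD; last 2 first.
  - by move=> x _; rewrite lee_fin mulr_ge0 ?inv_r_ge0.
  - by move=> x _; rewrite lee_fin mulr_ge0 ?rho_ge0 ?inv_r_ge0.
  rewrite esum_delta ?inv_r_ge0//; congr (_ + _)%E.
  under eq_esum do rewrite EFinM.
  rewrite esumZl ?inv_r_ge0// ?esum_rho 1?muleC// => x _.
  by rewrite lee_fin rho_ge0.
rewrite (eq_esum inner).
rewrite esumD; last 2 first.
- by move=> h _; rewrite lee_fin inv_r_ge0.
- by move=> h _; rewrite -EFinM lee_fin mulr_ge0 ?inv_r_ge0// mulr_ge0// zeta_ge0.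
rewrite esumZl; last 2 first.
- by rewrite mulr_ge0// zeta_ge0.
- by move=> h _; rewrite lee_fin inv_r_ge0.
rewrite !IH// -EFinM -EFinD mulr_sumr; congr (_ + _)%:E; apply: eq_bigr => u uw.
have su : s \notin u by apply/negP => /(fintype.subsetP uw); rewrite finset.setD11.
by rewrite finset.cardsU1 su exprS mulrCA.
Qed.

End Vectors.

(** * Averaging the criterion over the candidates for one component *)

Lemma esum_lin {R : realType} {T : choiceType} (I : set T) (r1 r2 s1 s2 : R)
    (f1 f2 : T -> R) :
  0 <= r1 -> 0 <= r2 -> (forall i, 0 <= f1 i) -> (forall i, 0 <= f2 i) ->
  \esum_(i in I) (f1 i)%:E = s1%:E -> \esum_(i in I) (f2 i)%:E = s2%:E ->
  \esum_(i in I) (r1 * f1 i + r2 * f2 i)%:E = (r1 * s1 + r2 * s2)%:E.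
Proof.
move=> r10 r20 f10 f20 E1 E2; under eq_esum do rewrite EFinD !EFinM.
rewrite esumD; try by move=> i _; rewrite -EFinM lee_fin mulr_ge0.
rewrite !esumZl ?E1 ?E2 -?EFinM -?EFinD//.
- by move=> i _; rewrite lee_fin.
- by move=> i _; rewrite lee_fin.
Qed.

(** Handles one coordinate [x] of [h] when [l] has entry [y] there. In the expanded product the two
    deltas exclude each other as [y] is nonzero, each mixed term leaves [rho a y], and the last is
    bounded by [esum_rho_conv]. *)
Lemma esum_coord_pair_le {R : realType} (a : R) (y : int) (b0 b1 b0' b1' : R) :
  1 < a -> y != 0 -> 0 <= b0 -> 0 <= b1 -> 0 <= b0' -> 0 <= b1' ->
  (\esum_(x in [set: int])
     (((x == 0)%:R * b0 + rho a x * b1) *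
      ((x + y == 0)%:R * b0' + rho a (x + y) * b1'))%:E <=
   (rho a y *
    (b0 * b1' + b1 * (b0' + 2 `^ (a + 1) * (2 * zeta a) * b1')))%:E)%E.
Proof.
move=> a1 y0 h0 h1 h0' h1'; have a0 : a != 0 by rewrite gt_eqF// (lt_trans ltr01).
have pt x : (((x == 0)%:R * b0 + rho a x * b1) *
    ((x + y == 0)%:R * b0' + rho a (x + y) * b1') =
    (x == 0)%:R * (rho a y * b0 * b1') + (x == - y)%:R * (rho a y * b1 * b0') +
    b1 * b1' * (rho a x * rho a (x + y))).
  have [->|x0] := eqVneq x 0.
    by rewrite rho0// add0r (negPf y0) [0 == - y]eq_sym oppr_eq0 (negPf y0) /=; ring.
  rewrite addr_eq0; have [->|xy] := eqVneq x (- y); last by rewrite /=; ring.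
  by rewrite addNr rho0// rhoN /=; ring.
under eq_esum do rewrite pt.
under eq_esum do rewrite 2!EFinD.
rewrite !esumD; try by move=> x _; rewrite -?EFinD lee_fin ?addr_ge0 ?mulr_ge0 ?rho_ge0.
rewrite !esum_delta ?mulr_ge0 ?rho_ge0//.
under eq_esum do rewrite EFinM.
rewrite esumZl ?mulr_ge0//; last by move=> x _; rewrite lee_fin mulr_ge0 ?rho_ge0.
apply: le_trans (leeD2l _ (lee_wpmul2l _ (esum_rho_conv a y a1 y0))) _.
  by rewrite lee_fin mulr_ge0.
rewrite -EFinM -!EFinD lee_fin le_eqVlt; apply/orP; left; apply/eqP; ring.
Qed.

Section Average.
Context {R : realType} {d : nat}.
Local Notation vec := {ffun 'I_d -> int}.
Implicit Types (h l : vec) (k : 'I_d) (a : R) (g : {set 'I_d} -> R)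
  (z : 'I_d -> nat).

(** Full-length counterpart of [zprefix]: vectors in [last_at] vanish beyond [k], so both give the
    same dot product, see [dotz_restr]. *)
Definition updz z k (c : nat) : 'I_d -> nat := fun j => if j == k then c else z j.

Definition below k : {set 'I_d} := [set j : 'I_d | (j < k)%N]%SET.

(** The dual-lattice vectors whose last nonzero coordinate is [k]. *)
Definition last_at (n : nat) k z : set vec :=
  supp_in (k |: below k) `&` [set l : vec | (l k != 0) && (n%:Z %| dotz l z)%Z].

(* [Tcrit] rewritten as a single double sum over [Z^d], see [critsum_Tcrit]. *)
Definition critsum (n : nat) a g k z : \bar R :=
  \esum_(h in [set: vec]) \esum_(l in last_at n k z)
    (inv_r a g h * inv_r a g (vadd h l))%:E.

Lemma supp_in_setU1C k : supp_in (k |: finset.setC (finset.set1 k)) = setT :> set vec.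
Proof.
apply/seteqP; split => // h _; apply/supp_inP => j.
by rewrite !inE orbN.
Qed.

Lemma vadd_upd h l k x y : vadd (upd h k x) (upd l k y) = upd (vadd h l) k (x + y).
Proof. by apply/ffunP => j; rewrite !ffunE; case: ifP. Qed.

Lemma dotz_upd l k y z c :
  dotz (upd l k y) (updz z k c) = y * c%:Z + \sum_(j < d | j != k) l j * (z j)%:Z.
Proof.
rewrite /dotz (bigD1 k)//= ffunE /updz eqxx; congr (_ + _).
by apply: eq_bigr => j /negPf jk; rewrite ffunE jk.
Qed.

Lemma below_subset k : below k \subset finset.setC (finset.set1 k).
Proof.
by apply/fintype.subsetP => j; rewrite !inE; apply: contraTN => /eqP ->; rewrite ltnn.
Qed.

(** Coordinate [k] is separated in both vectors ([y] in [l], [x] in [h]), so that [c] occurs only in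
    the congruence [n | y c + e l] and its sum becomes [sol_count]. The one-dimensional estimates
    remove [x] and [y], and the other coordinates factor. *)
Lemma sum_critsum_le n a g k z : (0 < n)%N -> 1 < a -> (forall u, 0 <= g u) ->
  (\sum_(c < n | val c \in Un n) critsum n a g k (updz z k c) <=
   (2 `^ (a + 1) *
    (\sum_(u : {set 'I_d} | k \in u) g u * (2 * zeta a) ^+ #|u|) *
    (\sum_(u : {set 'I_d}) g u * (2 * zeta a) ^+ #|u|))%:E)%E.
Proof.
move=> n0 a1 g0; set Z := 2 * zeta a; set G := inv_r a g.
have a0 : a != 0 by rewrite gt_eqF// (lt_trans ltr01).
have Z0 : 0 <= Z by rewrite mulr_ge0// zeta_ge0.
have G0 h : 0 <= G h by exact: inv_r_ge0.
(* Weight of a vector whose coordinate [k] is nonzero, with the factor of that coordinate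
   removed. *)
pose G1 := inv_r a (fun u => g (k |: u)).
have G10 h : 0 <= G1 h by exact: inv_r_ge0.
set K := finset.setC (finset.set1 k).
have kK : k \notin K by rewrite !inE eqxx.
have kB : k \notin below k by rewrite inE ltnn.
pose e l : int := \sum_(j < d | j != k) l j * (z j)%:Z.
pose c1 := 2 `^ (a + 1) * Z.
have c10 : 0 <= c1 by rewrite mulr_ge0 ?powR_ge0.
(* The bracket in [esum_coord_pair_le] for [b0 = G h], [b1 = G1 h], [b0' = G q], [b1' = G1 q]. *)
pose Dd h q := G h * G1 q + G1 h * (G q + c1 * G1 q).
have Dd0 h q : 0 <= Dd h q by rewrite addr_ge0// mulr_ge0// addr_ge0// mulr_ge0.
pose A1 := \sum_(u : {set 'I_d} | u \subset K) g (k |: u) * Z ^+ #|u|.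
pose B0 := \sum_(u : {set 'I_d} | u \subset K) g u * Z ^+ #|u|.
have A10 : 0 <= A1 by apply: sumr_ge0 => u _; rewrite mulr_ge0 ?exprn_ge0.
have B00 : 0 <= B0 by apply: sumr_ge0 => u _; rewrite mulr_ge0 ?exprn_ge0.
have sG : \esum_(h in supp_in K) (G h)%:E = B0%:E by exact: esum_inv_r.
have sG1 : \esum_(h in supp_in K) (G1 h)%:E = A1%:E by exact: esum_inv_r.
pose t (c : 'I_n) l h y x : R := (y != 0)%:R * (n%:Z %| y * (val c)%:Z + e l)%Z%:R *
     (G (upd h k x) * G (upd (vadd h l) k (x + y))).
have t0 c l h y x : (0%R <= (t c l h y x)%:E)%E.
  by rewrite lee_fin /t; apply: mulr_ge0; apply: mulr_ge0; rewrite ?ler0n.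
have critsumE c : critsum n a g k (updz z k (val c)) =
  \esum_(l in supp_in (below k)) \esum_(h in supp_in K) \esum_(y in setT)
    \esum_(x in setT) (t c l h y x)%:E.
  rewrite /critsum /last_at -/G.
  under eq_esum do rewrite esum_mkcondr.
  rewrite esum_exchange; last first.
    by move=> h l _ _; case: ifP => // _; rewrite lee_fin mulr_ge0.
  rewrite esum_upd//; last first.
    move=> l; apply: esum_ge0 => h _; case: ifP => // _; rewrite lee_fin mulr_ge0//.
  apply: eq_esum => l _; rewrite [RHS]esum_exchange; last first.
    by move=> *; apply: esum_ge0.
  apply: eq_esum => y _; rewrite -(supp_in_setU1C k) esum_upd//; last first.
    by move=> h; case: ifP => // _; rewrite lee_fin mulr_ge0.
  apply: eq_esum => h _; apply: eq_esum => x _.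
  rewrite vadd_upd /t -dotz_upd; case: ifPn; rewrite ?inE ?notin_setE /= ffunE eqxx.
    by move=> /andP[-> ->]; rewrite !mul1r.
  by move=> /negP; rewrite negb_and => /orP[|] /negPf ->; rewrite ?mulr0 ?mul0r.
have step1 : (\sum_(c < n | val c \in Un n) critsum n a g k (updz z k c) =
  \esum_(l in supp_in (below k)) \esum_(h in supp_in K) \esum_(y in setT)
  \esum_(x in setT) ((y != 0)%:R * sol_count n y (e l) *
     (G (upd h k x) * G (upd (vadd h l) k (x + y))))%:E)%E.
  under eq_bigr do rewrite critsumE.
  rewrite -esum_sum; last by move=> *; do 3!apply: esum_ge0 => ? _.
  apply: eq_esum => l _; rewrite -esum_sum; last by move=> *; do 2!apply: esum_ge0 => ? _.
  apply: eq_esum => h _; rewrite -esum_sum; last by move=> *; apply: esum_ge0 => ? _.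
  apply: eq_esum => y _; rewrite -esum_sum//.
  apply: eq_esum => x _; rewrite sumEFin; congr EFin.
  by rewrite /t -mulr_suml -mulr_sumr.
(* Summing over [x] first leaves [sol_count n y (e l) * rho a y] times [Dd]; its sum over [y] then
   costs a factor [Z]. *)
have step2 l h : supp_in (below k) l -> supp_in K h ->
  (\esum_(y in setT) \esum_(x in setT) ((y != 0)%:R * sol_count n y (e l) *
     (G (upd h k x) * G (upd (vadd h l) k (x + y))))%:E <= (Z * Dd h (vadd h l))%:E)%E.
  move=> /supp_inP lB /supp_inP hK.
  have hk : h k = 0 by exact: hK.
  have hlk : vadd h l k = 0 by rewrite ffunE hk lB.
  apply: (@le_trans _ _ (\esum_(y in setT)
      ((Dd h (vadd h l))%:E * (sol_count n y (e l) * rho a y)%:E)%E)).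
    apply: le_esum => y _; have [->|y0] := eqVneq y 0.
      rewrite esum1; first by rewrite rho0// mulr0 mule0.
      by move=> x _; rewrite !mul0r.
    rewrite mul1r; under eq_esum do rewrite EFinM /G !inv_r_upd// -/G -/G1.
    rewrite esumZl ?sol_count_ge0//; last first.
      move=> x _; rewrite lee_fin; apply: mulr_ge0; apply: addr_ge0;
        apply: mulr_ge0; by rewrite ?ler0n ?rho_ge0 ?G0 ?G10.
    rewrite -EFinM mulrCA EFinM lee_wpmul2l ?lee_fin ?sol_count_ge0//.
    rewrite [Dd _ _ * _]mulrC; exact: esum_coord_pair_le.
  rewrite esumZl//; last first.
    by move=> y _; rewrite lee_fin mulr_ge0 ?rho_ge0 ?sol_count_ge0.
  by rewrite mulrC EFinM lee_wpmul2l ?lee_fin// esum_sol_count_le.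
have step3 : (\esum_(h in supp_in K) \esum_(q in supp_in K) (Z * Dd h q)%:E =
   (Z * (B0 * A1 + A1 * (B0 + c1 * A1)))%:E)%E.
  have sq h : \esum_(q in supp_in K) (Z * Dd h q)%:E =
      ((Z * A1) * G h + (Z * (B0 + c1 * A1)) * G1 h)%:E.
    transitivity (\esum_(q in supp_in K)
      ((Z * (G h + c1 * G1 h)) * G1 q + (Z * G1 h) * G q)%:E).
      by apply: eq_esum => q _; congr EFin; rewrite /Dd; ring.
    rewrite (esum_lin _ _ _ A1 B0)//; first by congr EFin; ring.
    - by apply: mulr_ge0 => //; apply: addr_ge0 => //; exact: mulr_ge0.
    - exact: mulr_ge0.
  under eq_esum do rewrite sq.
  rewrite (esum_lin _ _ _ B0 A1)//; first by congr EFin; ring.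
  - exact: mulr_ge0.
  - by apply: mulr_ge0 => //; apply: addr_ge0 => //; exact: mulr_ge0.
have su (u : {set 'I_d}) : u \subset K -> k \notin u.
  by move=> uK; apply: contra kK => /(fintype.subsetP uK).
(* [Z * A1] collects the sets containing [k], the extra [Z] being the factor of [k] itself. *)
have FE : \sum_(u : {set 'I_d} | u \subset K) g (k |: u) * Z ^+ #|k |: u| = Z * A1.
  rewrite mulr_sumr; apply: eq_bigr => u /su ku.
  by rewrite finset.cardsU1 ku exprS mulrCA.
have BE : \sum_(u : {set 'I_d}) g u * Z ^+ #|u| = B0 + Z * A1.
  rewrite -FE -sum_subsetU1//; apply: eq_bigl => u; apply/esym/fintype.subsetP => j _.
  by rewrite !inE orbN.
have AE : \sum_(u : {set 'I_d} | k \in u) g u * Z ^+ #|u| = Z * A1.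
  move: BE; rewrite (bigID (fun u : {set 'I_d} => k \in u))/= addrC.
  rewrite (eq_bigl (fun u : {set 'I_d} => u \subset K)) => [/addrI//|u].
  by rewrite finset.subsetC finset.sub1set inE.
rewrite AE BE step1.
apply: (@le_trans _ _ (\esum_(l in supp_in (below k)) \esum_(h in supp_in K)
    (Z * Dd h (vadd h l))%:E)%E).
  by apply: le_esum => l ?; apply: le_esum => h ?; exact: step2.
rewrite esum_exchange; last by move=> *; rewrite lee_fin mulr_ge0.
(* For fixed [h] the map from [l] to [q = h + l] is injective, so [q] may range freely and the
   double sum factors. *)
apply: (@le_trans _ _ (\esum_(h in supp_in K) \esum_(q in supp_in K) (Z * Dd h q)%:E)).
  apply: le_esum => h /supp_inP hK.
  apply: (esum_inj_le (vadd h) (fun q => (Z * Dd h q)%:E)).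
    move=> l l' _ _ /ffunP E; apply/ffunP => j; have := E j.
    by rewrite !ffunE => /addrI.
  move=> l /supp_inP lB; apply/supp_inP => j jK; rewrite ffunE hK// lB//.
  by apply: contra jK => /(fintype.subsetP (below_subset k)).
rewrite step3 lee_fin /c1.
(* The mixed terms carry coefficient 2, which is enlarged to [2 ^ (a + 1)] so that the second factor
   becomes [B0 + Z * A1]. *)
have p2 : 2 <= 2 `^ (a + 1) :> R.
  by rewrite -[leLHS]powRr1// ler_powR// ?ler1n//; lra.
have W0 : 0 <= Z * A1 * B0 by apply: mulr_ge0 => //; exact: mulr_ge0.
have := ler_wpM2r W0 p2.
set P := 2 `^ (a + 1); move=> H.
rewrite [leLHS](_ : _ = 2 * (Z * A1 * B0) + P * (Z * A1) * (Z * A1)); last by ring.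
rewrite mulrDr lerD2r; apply: le_trans H _; rewrite le_eqVlt; apply/orP; left.
by apply/eqP; ring.
Qed.

End Average.

(** * Relating the double sums to [Ssum] and to the CBC criterion *)

Section Criterion.
Context {R : realType} {d : nat}.
Local Notation vec := {ffun 'I_d -> int}.
Implicit Types (h l t : vec) (k : 'I_d) (a : R) (g : {set 'I_d} -> R)
  (z : 'I_d -> nat).

Lemma critsum_ge0 n a g k z : (forall u, 0 <= g u) -> (0 <= critsum n a g k z)%E.
Proof.
move=> g0; apply: esum_ge0 => h _; apply: esum_ge0 => l _.
by rewrite lee_fin mulr_ge0 ?inv_r_ge0.
Qed.

Lemma critsum_poweR_le n a g k z (p : R) : (forall u, 0 <= g u) -> 0 < p -> p <= 1 ->
  (critsum n a g k z `^ p <= critsum n (a * p) (fun u => (g u `^ p)%R) k z)%E.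
Proof.
move=> g0 p0 p1; have gg h l : (0 <= (inv_r a g h * inv_r a g (vadd h l))%:E)%E.
  by rewrite lee_fin mulr_ge0 ?inv_r_ge0.
apply: le_trans (esum_poweR_le _ _ _ _ p0 p1) _.
  by move=> h _; exact: esum_ge0.
apply: le_esum => h _; apply: le_trans (esum_poweR_le _ _ _ _ p0 p1) _ => //.
by apply: le_esum => l _; rewrite poweR_EFin powRM ?inv_r_ge0// !inv_r_powR.
Qed.

Lemma last_at_cover n z l : l != 0 -> (n%:Z %| dotz l z)%Z ->
  exists k, last_at n k z l.
Proof.
move=> l0 ld; have [k0 lk0] : exists k, l k != 0.
  apply/existsP; apply: contraNT l0; rewrite negb_exists => /forallP H.
  by apply/eqP/ffunP => j; rewrite ffunE; apply/eqP; rewrite -[_ == _]negbK H.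
have := @arg_maxnP _ k0 (fun k => l k != 0) val lk0.
case=> k lk kmax; exists k; split => /=; last by rewrite lk.
apply/supp_inP => j; rewrite !inE negb_or -leqNgt => /andP[jk kj].
apply/eqP; apply: contraNT jk => /kmax /= jk'; apply/eqP/val_inj/eqP.
by rewrite eqn_leq kj andbT.
Qed.

(** Covering suffices for this direction: each admissible [l] lies in some [last_at], and the
    remaining terms are nonnegative. *)
Lemma Ssum_le_sum_critsum n a g z : (forall u, 0 <= g u) ->
  (Ssum n a g z <= \sum_(k < d) critsum n a g k z)%E.
Proof.
move=> g0; have gg h l : (0 <= (inv_r a g h * inv_r a g (vadd h l))%:E)%E.
  by rewrite lee_fin mulr_ge0 ?inv_r_ge0.
rewrite -esum_sum; last by move=> *; exact: esum_ge0.
apply: le_esum => h _; under eq_bigr do rewrite esum_mkcond.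
rewrite -esum_sum; last by move=> l k _ _; case: ifP.
rewrite [leLHS]esum_mkcond; apply: le_esum => l _.
case: ifPn => [/set_mem[l0 ld]|_]; last by apply: sume_ge0 => k _; case: ifP.
have [k lk] := last_at_cover n z l l0 ld.
rewrite (bigD1 k)//= mem_set// leeDl//.
by apply: sume_ge0 => j _; case: ifP.
Qed.

Lemma esum_vadd (w : {set 'I_d}) (f : vec -> \bar R) : (forall h, (0 <= f h)%E) ->
  \esum_(h in [set: vec]) f h =
  \esum_(h in supp_in w) \esum_(t in supp_in (finset.setC w)) f (vadd h t).
Proof.
move=> f0; rewrite (@esum_esum _ _ _ (supp_in w) (fun=> supp_in (finset.setC w)))//.
rewrite (@reindex_esum _ _ _ (supp_in w `*`` (fun=> supp_in (finset.setC w))) _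
  (fun p => vadd p.1 p.2))//; split => //.
- move=> [h t] [h' t']; rewrite !inE => -[/= /supp_inP H /supp_inP T].
  move=> [/= /supp_inP H' /supp_inP T'] /ffunP E.
  congr (_, _); apply/ffunP => j; have := E j; rewrite !ffunE.
    have [jw|jw] := boolP (j \in w); last by rewrite H// H'.
    by rewrite T ?inE ?jw// T' ?inE ?jw// !addr0.
  have [jw|jw] := boolP (j \in w); last by rewrite H// H'// !add0r.
  by rewrite T ?inE ?jw// T' ?inE ?jw.
- move=> h _; exists ([ffun j => if j \in w then h j else 0],
    [ffun j => if j \in w then 0 else h j]); last first.
    by apply/ffunP => j; rewrite !ffunE /=; case: ifP; rewrite ?addr0 ?add0r.
  split=> /=; apply/supp_inP => j; rewrite ffunE ?inE; first by move=> /negPf ->.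
  by rewrite negbK => ->.
Qed.

(** The supports are disjoint, so the product splits; only the weight still couples [h] and [t],
    through the union of supports. *)
Lemma inv_r_vadd a g h t (w : {set 'I_d}) : supp_in w h ->
  supp_in (finset.setC w) t ->
  inv_r a g (vadd h t) =
  (\prod_(j in supp h) rho a (h j)) * inv_r a (fun u => g (supp h :|: u)) t.
Proof.
move=> /supp_inP H /supp_inP T.
have ht j : j \in supp h -> t j = 0.
  move=> jh; apply: T; rewrite inE negbK; apply: contraTT jh => /H hj.
  by rewrite inE hj eqxx.
have sE : supp (vadd h t) = supp h :|: supp t.
  apply/setP => j; rewrite !inE ffunE; have [h0|h0] := eqVneq (h j) 0.
    by rewrite h0 add0r.
  by rewrite ht ?inE// addr0 h0.
rewrite !inv_rE sE (eq_bigl [in [predU supp h & supp t]]); last first.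
  by move=> j; rewrite !inE.
rewrite bigU/=; last first.
  rewrite finset.disjoints_subset; apply/fintype.subsetP => j /ht tj.
  by rewrite !inE tj eqxx.
rewrite mulrCA; congr (_ * (_ * _)).
  by apply: eq_bigr => j /ht tj; rewrite ffunE tj addr0.
apply: eq_bigr => j jt; rewrite ffunE.
have [h0|h0] := eqVneq (h j) 0; first by rewrite h0 add0r.
by move: jt; rewrite inE ht ?inE// eqxx.
Qed.

(** Beyond [k] the vectors [h] and [h + l] agree, so [rho a] occurs squared there; this is the
    source of [zeta (2 * alpha)] in [Tcrit]. *)
Lemma rho2 a x : rho (2 * a) x = rho a x * rho a x.
Proof.
rewrite /rho mulrC -mulNr powRrM -[2]/(2%:R) powR_mulrn ?powR_ge0// expr2.
Qed.

Definition restr k h : {ffun 'I_k.+1 -> int} :=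
  [ffun i => h (widen_ord (ltn_ord k) i)].

Lemma supp_restr k h : supp_in (k |: below k) h ->
  widen_ord (ltn_ord k) @: supp (restr k h) = supp h.
Proof.
move=> /supp_inP H; apply/setP => j; apply/imsetP/idP.
  by move=> [i]; rewrite !inE ffunE => hi ->.
rewrite inE => hj; have jk : (j < k.+1)%N.
  have : j \in k |: below k by apply: contraNT hj => /H ->.
  by rewrite !inE -val_eqE /=; lia.
exists (Ordinal jk); last exact/val_inj.
by rewrite inE ffunE (_ : widen_ord _ _ = j)//; exact/val_inj.
Qed.

Lemma inv_r_restr k h a (b : {set 'I_k.+1} -> R) g :
  supp_in (k |: below k) h -> (forall u, b u = g (widen_ord (ltn_ord k) @: u)) ->
  inv_r a b (restr k h) = inv_r a g h.
Proof.
move=> hB bg; rewrite !inv_rE bg supp_restr//; congr (_ * _).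
rewrite -[in RHS](supp_restr k h hB) big_imset/=; last first.
  by move=> i j _ _ /(congr1 val) /= /val_inj.
by apply: eq_bigr => i _; rewrite ffunE.
Qed.

Lemma restr_vadd k h l : restr k (vadd h l) = vadd (restr k h) (restr k l).
Proof. by apply/ffunP => i; rewrite !ffunE. Qed.

Lemma restr_bij k :
  set_bij (supp_in (k |: below k)) [set: {ffun 'I_k.+1 -> int}] (restr k).
Proof.
have ltk (j : 'I_d) : j \in k |: below k -> (j < k.+1)%N.
  by rewrite !inE -val_eqE /=; lia.
split => //.
- move=> h h'; rewrite !inE => /supp_inP H /supp_inP H' /ffunP E.
  apply/ffunP => j; have [jB|jB] := boolP (j \in k |: below k); last by rewrite H// H'.
  have := E (Ordinal (ltk j jB)); rewrite !ffunE.
  by rewrite (_ : widen_ord _ _ = j)//; exact/val_inj.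
- move=> f _; exists [ffun j : 'I_d => oapp f 0 (insub (val j))].
    apply/supp_inP => j; rewrite ffunE; case: insubP => //= i jk _.
    rewrite !inE negb_or -leqNgt -val_eqE /= => /andP[]; lia.
  by apply/ffunP => i; rewrite !ffunE /= valK.
Qed.

Lemma dotz_restr k l z c : supp_in (k |: below k) l ->
  dotz (restr k l) (zprefix z k c) = dotz l (updz z k c).
Proof.
move=> /supp_inP lB; rewrite /dotz [RHS](bigID (fun j : 'I_d => (j < k.+1)%N))/=.
rewrite [X in _ = _ + X]big1 ?addr0; last first.
  move=> j jk; rewrite lB ?mul0r// !inE negb_or -val_eqE /=.
  by apply/andP; split; lia.
rewrite (big_ord_narrow (ltn_ord k)); apply: eq_bigr => i _.
rewrite ffunE /zprefix /updz -val_eqE /=; congr (_ * Posz _).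
by case: (ltngtP i k) => // ki; have := ltn_ord i; lia.
Qed.

Lemma thetaE n a g k z c (w : {set 'I_d}) :
  theta n a (fun u : {set 'I_k.+1} => g (widen_ord (ltn_ord k) @: u :|: w))
    (zprefix z k c) =
  \esum_(h in supp_in (k |: below k)) \esum_(l in last_at n k (updz z k c))
    (inv_r a (fun u => g (u :|: w)) h *
     inv_r a (fun u => g (u :|: w)) (vadd h l))%:E.
Proof.
rewrite /theta (reindex_esum _ _ _ _ (restr_bij k)); apply: eq_esum => h hB.
set Th := [set l | _].
have ThP l : supp_in (k |: below k) l ->
    Th (restr k l) <-> (l k != 0) && (n%:Z %| dotz l (updz z k c))%Z.
  move=> lB; rewrite /Th /= dotz_restr//.
  have wk (j : 'I_k.+1) : val j == k -> widen_ord (ltn_ord k) j = k.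
    by move=> /eqP E; apply/val_inj.
  split=> [[/existsP[j /andP[/wk E]]]|/andP[lk ->]].
    by rewrite ffunE E => -> ->.
  split=> //; apply/existsP; exists ord_max; rewrite /= eqxx ffunE wk//=.
have Thb : set_bij (last_at n k (updz z k c)) Th (restr k).
  have [_ inj surj] := restr_bij k; split.
  - by move=> l [lB H]; apply/(ThP l lB).
  - move=> l l' /set_mem[lB _] /set_mem[lB' _]; apply: inj; exact: mem_set.
  - move=> f fT; have [l lB lf] := surj f I; exists l => //; split => //.
    by apply/(ThP l lB); rewrite lf.
rewrite (reindex_esum _ _ _ _ Thb); apply: eq_esum => l [lB _].
pose b (u : {set 'I_k.+1}) := g (widen_ord (ltn_ord k) @: u :|: w).
rewrite -restr_vadd; congr (_ * _)%:E.
  by apply: (inv_r_restr k h a b (fun u => g (u :|: w))).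
apply: (inv_r_restr k (vadd h l) a b (fun u => g (u :|: w))) => //.
move: hB lB => /supp_inP hB /supp_inP lB; apply/supp_inP => j jB.
by rewrite ffunE hB// lB.
Qed.

(** Split the first vector as [h + t] with [t] supported beyond [k]. Summing out [t] by [esum_inv_r]
    with exponent [2 * a] produces the sum over [w] in [Tcrit]. *)
Lemma critsum_Tcrit n a g k z c : 1 < a -> (forall u, 0 <= g u) ->
  critsum n a g k (updz z k c) = Tcrit n a g k (zprefix z k c).
Proof.
move=> a1 g0; set B := k |: below k; set L := last_at n k (updz z k c).
have a21 : 1 < 2 * a by lra.
have gg h l : (0 <= (inv_r a g h * inv_r a g (vadd h l))%:E)%E.
  by rewrite lee_fin mulr_ge0 ?inv_r_ge0.
have gw w h l : (0 <= (inv_r a (fun u => g (u :|: w)) h *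
     inv_r a (fun u => g (u :|: w)) (vadd h l))%:E)%E.
  by rewrite lee_fin mulr_ge0 ?inv_r_ge0.
have Z0 m : 0 <= (2 * zeta (2 * a)) ^+ m by rewrite exprn_ge0// mulr_ge0// zeta_ge0.
rewrite /critsum (esum_vadd B); last by move=> h; exact: esum_ge0.
rewrite /Tcrit; under [RHS]eq_bigr => w _.
  rewrite thetaE -/B -/L -esumZl//; last by move=> h _; exact: esum_ge0.
  under eq_esum do rewrite -esumZl//.
  over.
rewrite -esum_sum; last first.
  by move=> h w _ _; apply: esum_ge0 => l _; apply: mule_ge0 => //; rewrite lee_fin.
apply: eq_esum => h hB; rewrite esum_exchange//.
rewrite -esum_sum; last by move=> l w _ _; apply: mule_ge0 => //; rewrite lee_fin.
apply: eq_esum => l [lB _].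
have hlB : supp_in B (vadd h l).
  move: hB lB => /supp_inP hB /supp_inP lB; apply/supp_inP => j jB.
  by rewrite ffunE hB// lB.
pose pr h := \prod_(j in supp h) rho a (h j).
(* The same [t] occurs in both factors, so their weights merge into one weight depending on its
   support [w]. *)
pose b w := g (supp h :|: w) * g (supp (vadd h l) :|: w).
transitivity (\esum_(t in supp_in (finset.setC B))
    ((pr h * pr (vadd h l))%:E * (inv_r (2 * a) b t)%:E)%E).
  apply: eq_esum => t tC; rewrite -EFinM; congr EFin.
  have -> : vadd (vadd h t) l = vadd (vadd h l) t.
    by apply/ffunP => j; rewrite !ffunE addrAC.
  rewrite (inv_r_vadd a g h t B)// (inv_r_vadd a g _ t B)// -/(pr _) -/(pr _).
  rewrite !inv_rE (eq_bigr _ (fun j _ => rho2 a (t j))) big_split /b/=; ring.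
rewrite esumZl; last 2 first.
- by rewrite mulr_ge0// prodr_ge0// => j _; exact: rho_ge0.
- by move=> t _; rewrite lee_fin inv_r_ge0// => u; rewrite mulr_ge0.
rewrite esum_inv_r//; last by move=> u; rewrite mulr_ge0.
rewrite -EFinM mulr_sumr -sumEFin; apply: eq_big => w.
  apply/fintype.subsetP/forall_inP => H j jw; have := H j jw; rewrite !inE -val_eqE /=; lia.
by move=> _; rewrite -EFinM; congr EFin; rewrite !inv_rE /b /pr; ring.
Qed.

End Criterion.

(** * Counting units and assembling the bound *)

Lemma card_Un n : (1 < n)%N -> #|[pred c : 'I_n | val c \in Un n]| = totient n.
Proof.
move=> n1; rewrite totient_count_coprime big_mkord -sum1_card big_mkcond /=.
apply: eq_bigr => c _; rewrite !inE ltn_ord andbT coprime_sym.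
have [->|c0] := posnP (val c); last by rewrite /=; case: coprime.
by rewrite /coprime gcdn0 gtn_eqF.
Qed.

(** Double counting: [u] is met once for each [k] in it, which is where the factor [|u|] comes
    from. *)
Lemma sum_card_mem {R : realType} d (F : {set 'I_d} -> R) :
  \sum_(k < d) \sum_(u : {set 'I_d} | k \in u) F u =
  \sum_(u : {set 'I_d} | u != finset.set0) #|u|%:R * F u.
Proof.
rewrite (exchange_big_dep xpredT)//= [RHS]big_mkcond; apply: eq_bigr => u _.
rewrite sumr_const mulr_natl; case: eqP => //= ->.
by rewrite cards0.
Qed.

Theorem theorem1 (R : realType) (n d : nat) (alpha : R) (gamma : {set 'I_d} -> R)
  (z : 'I_d -> nat) (lambda : R) :
  (2 <= n)%N -> (1 <= d)%N -> 1 < alpha ->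
  (forall u, 0 < gamma u) -> gamma finset.set0 = 1 ->
  is_CBC n alpha gamma z ->
  alpha^-1 < lambda -> lambda <= 1 ->
  (Ssum n alpha gamma z <=
   (((2 `^ (2 * alpha * lambda + 1) + 1) / (totient n)%:R *
     (\sum_(u : {set 'I_d} | u != finset.set0)
        #|u|%:R * gamma u `^ lambda * (2 * zeta (alpha * lambda)) ^+ #|u|) *
     (\sum_(u : {set 'I_d})
        gamma u `^ lambda * (2 * zeta (alpha * lambda)) ^+ #|u|)) `^ lambda^-1)%:E)%E.
Proof.
move=> n2 _ alpha1 gamma_gt0 _ cbc lambda_gt lambda1.
have alpha0 : 0 < alpha by lra.
have lambda0 : 0 < lambda by rewrite (lt_trans _ lambda_gt)// invr_gt0.
have n0 : (0 < n)%N by lia.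
have gamma0 u : 0 <= gamma u by exact: ltW.
set a := alpha * lambda.
have a1 : 1 < a by rewrite /a -(mulfV (lt0r_neq0 alpha0)) ltr_pM2l.
pose g u := gamma u `^ lambda; have g0 u : 0 <= g u by exact: powR_ge0.
pose F u := g u * (2 * zeta a) ^+ #|u|.
have F0 u : 0 <= F u by rewrite mulr_ge0// exprn_ge0// mulr_ge0// zeta_ge0.
pose A k := \sum_(u : {set 'I_d} | k \in u) F u.
pose B := \sum_(u : {set 'I_d}) F u.
have phi0 : 0 < (totient n)%:R :> R by rewrite ltr0n totient_gt0.
(* The minimum is at most the average: [totient n] copies of the left side are compared with the
   candidates [c] one by one. *)
have E_le k : (critsum n alpha gamma k z `^ lambda <=
    (2 `^ (a + 1) * A k * B / (totient n)%:R)%R%:E)%E.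
  rewrite mulrC EFinM lee_pdivlMl//.
  apply: le_trans (sum_critsum_le n a g k z n0 a1 g0).
  rewrite -(card_Un n n2) -sumr_const -sumEFin ge0_sume_distrl; last first.
    by move=> c _; rewrite lee_fin.
  apply: lee_sum => c cU; rewrite mul1e.
  apply: le_trans (critsum_poweR_le _ _ _ _ _ _ gamma0 lambda0 lambda1).
  apply: gt0_ler_poweR; first exact: ltW.
  - by rewrite in_itv/= leey critsum_ge0.
  - by rewrite in_itv/= leey critsum_ge0.
  (* Writing [z] as its own update at [k] puts both sides in the form compared by [is_CBC]. *)
  rewrite (_ : critsum n alpha gamma k z = critsum n alpha gamma k (updz z k (z k))).
    by rewrite !critsum_Tcrit//; apply: (proj2 (cbc k)).
  by congr critsum; apply/funext => j; rewrite /updz; case: eqP => // ->.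
rewrite -poweR_EFin; apply: le_poweR_inv => //.
  apply: esum_ge0 => h _; apply: esum_ge0 => l _.
  by rewrite lee_fin mulr_ge0 ?inv_r_ge0.
apply: le_trans (_ : ((\sum_(k < d) critsum n alpha gamma k z) `^ lambda <= _)%E).
  apply: gt0_ler_poweR; first exact: ltW.
  - rewrite in_itv/= leey andbT; apply: esum_ge0 => h _; apply: esum_ge0 => l _.
    by rewrite lee_fin mulr_ge0 ?inv_r_ge0.
  - by rewrite in_itv/= leey andbT sume_ge0// => k _; exact: critsum_ge0.
  exact: Ssum_le_sum_critsum.
apply: le_trans (sum_poweR_le _ _ _ _ _ lambda0 lambda1) _.
  by move=> k _; exact: critsum_ge0.
apply: le_trans (lee_sum _ (fun k _ => E_le k)) _.
rewrite sumEFin lee_fin -!mulr_suml -mulr_sumr sum_card_mem -/B.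
under [X in _ <= _ * X * _]eq_bigr do rewrite -mulrA.
set S := \sum_(u | _) _.
have S0 : 0 <= S by apply: sumr_ge0 => u _; rewrite mulr_ge0.
have B0 : 0 <= B by exact: sumr_ge0.
rewrite [leLHS](_ : _ = 2 `^ (a + 1) * (S * B / (totient n)%:R)); last by ring.
rewrite [leRHS](_ : _ = (2 `^ (2 * alpha * lambda + 1) + 1) *
  (S * B / (totient n)%:R)); last by ring.
apply: ler_wpM2r; first by rewrite divr_ge0 ?mulr_ge0// ltW.
(* Here [2 ^ (a + 1) <= 2 ^ (2 * a + 1) <= kappa], as [a] is positive. *)
apply: le_trans (_ : _ <= 2 `^ (2 * alpha * lambda + 1)) _; last by rewrite lerDl.
by rewrite ler_powR ?ler1n// -mulrA -/a; lra.
Qed.
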